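(* Let $R_{12}$ (resp. $R_{23}$) be the birational map on triples $(x^1,x^2,x^3)\in\mathcal B\times\mathcal B\times\mathcal B$ acting on the first (resp. last) two components as the tropical $R$ and trivially on the remaining component. Then $$R_{12}R_{23}R_{12}=R_{23}R_{12}R_{23}$$ as birational maps on $\mathcal B\times\mathcal B\times\mathcal B$.
   Context: Let $n\ge 4$. Variables are real; all maps and identities are rational (identities hold wherever both sides are defined). A set of variables for $\mathcal B$ is a tuple $x=(x_1,\dots,x_n,\bar x_{n-1},\dots,\bar x_1)$ of $2n-1$ real variables; level $\ell(x)=x_1\cdots x_n\bar x_{n-1}\cdots\bar x_1$; $\delta_{ij}$ Kronecker delta; empty products are $1$. **The $2n\times 2n$ matrix $M(x,z)$.** Write $M_{i,j}=M(x,z)_{i,j}$, $\ell=\ell(x)$, $\bar X_i=1+\bar x_i/x_i$. First column: $M_{1,1}=x_1/\bar x_1$; $M_{i,1}=x_1\cdots x_{i-1}(1+x_i/\bar x_i)$ for $2\le i\le n-1$; $M_{n,1}=x_1\cdots x_n$; $M_{n+1,1}=x_1\cdots x_{n-1}$; $M_{i,1}=\ell/(\bar x_1\cdots\bar x_{2n-i})$ for $n+2\le i\le 2n$. Other columns ($1\le i\le 2n$): $M_{i,j+1}=\frac{M_{i,j}}{x_j}+(\ell z-1)\big(\frac{\delta_{i,j}}{\bar x_j}+\delta_{i,j+1}\big)$ for $1\le j\le n-2$; $M_{i,n}=\frac{M_{i,n-1}}{x_{n-1}}+(\ell z-1)\big(\frac{\delta_{i,n-1}}{\bar x_{n-1}}+\delta_{i,n+1}\big)$;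 $M_{i,n+1}=\frac{M_{i,n-1}}{x_{n-1}x_n}+(\ell z-1)\big(\frac{\delta_{i,n-1}}{\bar x_{n-1}x_n}+\delta_{i,n}\big)$; $M_{i,2n}=z\frac{\bar x_1}{x_1}M_{i,1}+\delta_{i,2n}\frac{\bar x_1}{x_1}(1-\ell z)+\delta_{i,1}z(\ell z-1)$; $M_{i,2n-1}=z\bar x_1\bar X_2M_{i,1}+(1-\ell z)\big(\delta_{i,2n}\bar x_1\bar X_2+\delta_{i,2n-1}\frac{\bar x_2}{x_2}\big)$; $M_{i,2n-j}=\bar x_j\frac{\bar X_{j+1}}{\bar X_j}M_{i,2n+1-j}+(1-\ell z)\big(\delta_{i,2n+1-j}\bar x_j\frac{\bar X_{j+1}}{\bar X_j}+\delta_{i,2n-j}\frac{\bar x_{j+1}}{x_{j+1}}\big)$ for $2\le j\le n-2$. **The tropical $R$.** For generic $(x,y)$ there is a unique $(x',y')$ with $M(x,z)M(y,z)=M(x',z)M(y',z)$ identically in $z$ and $\ell(x)=\ell(y')\ne\ell(y)=\ell(x')$; the resulting birational map $(x,y)\mapsto(x',y')$ is denoted $R$. *)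

(* Defs.v *)
(* MathComp + multinomials; the reals are an arbitrary R : realType. *)
From mathcomp Require Import all_boot all_order all_algebra.
From mathcomp Require Import reals.
From mathcomp Require Import mpoly.

Set Implicit Arguments.
Unset Strict Implicit.
Unset Printing Implicit Defensive.

Import Order.TTheory GRing.Theory Num.Theory.
Local Open Scope ring_scope.

(* A rational map R^N ~~> R^M is given by M numerators over a common nonzero
   denominator, and acts on points as the partial function [ratmap_fun], which
   is undefined (None) where the denominator vanishes; partial maps compose by
   [pcomp]. *)

Record ratmap (R : realType) (N M : nat) := RatMap {
  rm_num : 'I_M -> {mpoly R[N]};
  rm_den : {mpoly R[N]};
  rm_den_neq0 : rm_den != 0
}.

Definition ratmap_fun (R : realType) (N M : nat) (f : ratmap R N M)
    (v : 'rV[R]_N) : option 'rV[R]_M :=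
  if (rm_den f).@[v 0] == 0 then None
  else Some (\row_i ((rm_num f i).@[v 0] / (rm_den f).@[v 0])).

Coercion ratmap_fun : ratmap >-> Funclass.

(* P holds on a nonempty Zariski-open subset of R^N *)
Definition generic (R : realType) (N : nat) (P : 'rV[R]_N -> Prop) : Prop :=
  exists2 q : {mpoly R[N]}, q != 0 & forall v : 'rV[R]_N, q.@[v 0] != 0 -> P v.

Definition birational (R : realType) (N : nat) (T : ratmap R N N) : Prop :=
  exists S : ratmap R N N,
    generic (fun v => pcomp S T v = Some v) /\
    generic (fun w => pcomp T S w = Some w).

(* Equality of partial maps as rational maps: generically both are defined, and
   they agree wherever both are defined. *)
Definition rational_eq (R : realType) (N M : nat)
    (f g : 'rV[R]_N -> option 'rV[R]_M) : Prop :=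
  generic (fun v => f v /\ g v) /\
  forall v u w, f v = Some u -> g v = Some w -> u = w.

(* x = (x_1, ..., x_n, xbar_{n-1}, ..., xbar_1) is a row vector of length
   2n - 1; in the accessors below the index i is 1-based, as on paper, so that
   xbar_i sits at (0-based) position 2n - 1 - i. *)

Definition dimB (n : nat) : nat := (2 * n).-1.

Definition coord (R : realType) (N : nat) (x : 'rV[R]_N) (k : nat) : R :=
  if insub k is Some i then x 0 i else 0.

Section Matrix.
Variables (R : realType) (n : nat) (x : 'rV[R]_(dimB n)).

Definition xv (i : nat) : R := coord x i.-1.
Definition xbar (i : nat) : R := coord x ((2 * n).-1 - i).
Definition Xbar (i : nat) : R := 1 + xbar i / xv i.

Definition level : R :=
  (\prod_(1 <= i < n.+1) xv i) * (\prod_(1 <= i < n) xbar i).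

(* All denominators in the definition of M(x,z) are nonzero. *)
Definition M_defined : Prop :=
  [/\ forall i, (1 <= i <= n)%N -> xv i != 0,
      forall i, (1 <= i <= n.-1)%N -> xbar i != 0
    & forall i, (2 <= i <= n - 2)%N -> Xbar i != 0].

Variable z : R.

Let delta (i j : nat) : R := (i == j)%:R.

(* Rows i and columns j are 1-based. *)
Definition Mcol1 (i : nat) : R :=
  if i == 1%N then xv 1 / xbar 1
  else if (i <= n.-1)%N then
    (\prod_(1 <= k < i) xv k) * (1 + xv i / xbar i)
  else if i == n then \prod_(1 <= k < n.+1) xv k
  else if i == n.+1 then \prod_(1 <= k < n) xv k
  else level / \prod_(1 <= k < (2 * n - i).+1) xbar k.

(* Mleft j i = M_{i,j} for 1 <= j <= n-1 *)
Fixpoint Mleft (j i : nat) : R :=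
  match j with
  | 0 => 0
  | 1 => Mcol1 i
  | (k.+1 as j').+1 =>
      Mleft j' i / xv j' +
      (level * z - 1) * (delta i j' / xbar j' + delta i j'.+1)
  end.

Definition Mcoln (i : nat) : R :=
  Mleft n.-1 i / xv n.-1 +
  (level * z - 1) * (delta i n.-1 / xbar n.-1 + delta i n.+1).

Definition Mcoln1 (i : nat) : R :=
  Mleft n.-1 i / (xv n.-1 * xv n) +
  (level * z - 1) * (delta i n.-1 / (xbar n.-1 * xv n) + delta i n).

(* Mright j i = M_{i,2n-j} for 0 <= j <= n-2 *)
Fixpoint Mright (j i : nat) : R :=
  match j with
  | 0 =>
      z * (xbar 1 / xv 1) * Mcol1 i
      + delta i (2 * n) * (xbar 1 / xv 1) * (1 - level * z)
      + delta i 1 * z * (level * z - 1)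
  | 1 =>
      z * xbar 1 * Xbar 2 * Mcol1 i
      + (1 - level * z) * (delta i (2 * n) * xbar 1 * Xbar 2
                           + delta i (2 * n - 1) * (xbar 2 / xv 2))
  | (k.+1 as j').+1 =>
      xbar j * (Xbar j.+1 / Xbar j) * Mright j' i
      + (1 - level * z)
        * (delta i (2 * n + 1 - j) * xbar j * (Xbar j.+1 / Xbar j)
           + delta i (2 * n - j) * (xbar j.+1 / xv j.+1))
  end.

Definition Mentry (i j : nat) : R :=
  if (j <= n.-1)%N then Mleft j i
  else if j == n then Mcoln i
  else if j == n.+1 then Mcoln1 i
  else Mright (2 * n - j) i.

Definition Mmx : 'M[R]_(2 * n) := \matrix_(i, j) Mentry i.+1 j.+1.

End Matrix.

(* The relation between (x,y) and (x',y') that defines the tropical R. *)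
Definition refactors (R : realType) (n : nat)
    (x y x' y' : 'rV[R]_(dimB n)) : Prop :=
  [/\ M_defined x', M_defined y',
      forall z : R, Mmx x z *m Mmx y z = Mmx x' z *m Mmx y' z
    & [/\ level x = level y', level y = level x' & level x != level y]].

(* T is the tropical R: a birational map of B x B sending generic (x,y) to the
   unique (x',y') related to it. *)
Definition is_tropicalR (R : realType) (n : nat)
    (T : ratmap R (dimB n + dimB n) (dimB n + dimB n)) : Prop :=
  birational T /\
  generic (fun v : 'rV[R]_(dimB n + dimB n) =>
    [/\ M_defined (lsubmx v), M_defined (rsubmx v) &
        exists2 w, T v = Some w &
          forall x' y' : 'rV[R]_(dimB n),
            refactors (lsubmx v) (rsubmx v) x' y' <-> row_mx x' y' = w]).

(* A point (x^1,x^2,x^3) of B x B x B is row_mx (row_mx x^1 x^2) x^3. *)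

Definition R12 (R : realType) (d : nat) (T : ratmap R (d + d) (d + d))
    (t : 'rV[R]_(d + d + d)) : option 'rV[R]_(d + d + d) :=
  omap (fun p => row_mx p (rsubmx t)) (T (lsubmx t)).

Definition R23 (R : realType) (d : nat) (T : ratmap R (d + d) (d + d))
    (t : 'rV[R]_(d + d + d)) : option 'rV[R]_(d + d + d) :=
  omap (fun p : 'rV[R]_(d + d) =>
          row_mx (row_mx (lsubmx (lsubmx t)) (lsubmx p)) (rsubmx p))
       (T (row_mx (rsubmx (lsubmx t)) (rsubmx t))).

(* Main.v *)
Require Import Defs.
From mathcomp Require Import all_boot all_order all_algebra.
From mathcomp Require Import boolp reals.
From mathcomp Require Import mpoly.
From mathcomp Require Import ring zify.

(** The braid relation holds because a product of three matrices
    M(x1,z) M(x2,z) M(x3,z) with pairwise distinct levels remembers its factors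
    once the order of the levels is known ([factorization3_uniq]).  Each
    application of the tropical R rewrites a product M(x,z) M(y,z) as another
    product of the same value and exchanges the two levels.  Both sides of the
    braid relation therefore preserve the triple product and turn levels
    (l1, l2, l3) into (l3, l2, l1), so they must give the same triple
    ([refactors_braid]).

    Uniqueness of the factorization comes from two properties of M(x,z), with
    l the level of x.  When l z = 1 the matrix has rank one and its columns are
    multiples of its first column ([Mmx_rank1]); when l z <> 1 it is invertible
    ([Mmx_unit]).  Hence, at z = 1/l1, the column space of the triple product
    is the line of the first column of M(x1,z), since the other two factors are
    invertible there.  The last entry of that column is l1, which fixes the
    scale, and the column together with the level determines x1
    ([Mcol1_inj]).  Now x2 and x3 follow in the same way, cancelling the
    factors already identified at z = 1/l2 and z = 1/l3.

    It remains to pass from relations between points to rational maps.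
    Genericity: T only satisfies its defining property on a nonempty open set,
    so the conditions at the second and third step have to be pulled back along
    the previous steps.  This is possible because T, and with it R12 and R23,
    is dominant ([generic_pullback]).  Agreement at every common point of
    definition, not only at generic ones: near any point where it is defined,
    a composite of rational maps is given by one fraction of polynomials, and
    two fractions that agree generically agree as soon as their denominators
    do not vanish ([rational_eq_of_generic]). *)

Set Implicit Arguments.
Unset Strict Implicit.
Unset Printing Implicit Defensive.

Import Order.TTheory GRing.Theory Num.Theory.
Local Open Scope ring_scope.

(** * Polynomials vanishing at every point *)

Lemma poly_eval0 (R : numDomainType) (p : {poly R}) :
  (forall t, p.[t] = 0) -> p = 0.
Proof.
move=> p0; pose rs := [seq (i%:R : R) | i <- iota 0 (size p)].
apply: (@roots_geq_poly_eq0 _ p rs).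
- by apply/allP => t _; rewrite /root p0.
- rewrite map_inj_uniq ?iota_uniq // => i j /eqP.
  by rewrite eqr_nat => /eqP.
- by rewrite size_map size_iota.
Qed.

(** Induction on the number of variables: for a fixed value of the first N
    variables, [muni p] becomes a univariate polynomial with infinitely many
    roots, so each of its coefficients vanishes as a function of these N
    variables. *)
Lemma mpoly_eval0 (R : numDomainType) N (p : {mpoly R[N]}) :
  (forall v : 'I_N -> R, p.@[v] = 0) -> p = 0.
Proof.
elim: N p => [|N IH] p p0; apply/mpolyP => m; rewrite mcoeff0.
  have mE (m' : 'X_{1..0}) : m' = m.
    by apply/mnmP => -[i hi]; have := hi; rewrite ltn0.
  have := p0 (fun=> 0); rewrite mevalE.
  have [mp|mp _] := boolP (m \in msupp p); last exact: memN_msupp_eq0.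
  rewrite (big_rem m) //= big_ord0 mulr1 big1_seq ?addr0 // => m' /andP[_].
  by rewrite mem_rem_uniq ?msupp_uniq // inE (mE m') eqxx.
have coef0 k : (muni p)`_k = 0.
  apply: IH => w.
  suff: map_poly (meval w) (muni p) = 0.
    by move/polyP/(_ k); rewrite coef_map coef0.
  apply: poly_eval0 => t.
  pose v (i : 'I_N.+1) := if unlift ord_max i is Some j then w j else t.
  rewrite -[RHS](p0 v) mevalE muniE rmorph_sum horner_sum.
  apply: eq_bigr => m' _ /=.
  rewrite -mul_polyC rmorphM /= map_polyC map_polyXn /=.
  rewrite hornerM hornerC hornerXn.
  rewrite mevalZ mevalX big_ord_recr /= -!mulrA; congr (_ * (_ * _)).
    apply: eq_bigr => i _; rewrite mnmE /v.
    have -> : widen_ord (leqnSn N) i = lift ord_max i.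
      by apply/val_inj; rewrite /= /bump leqNgt ltn_ord.
    by rewrite liftK.
  by rewrite /v unlift_none.
pose m0 := [multinom m (widen_ord (leqnSn N) i) | i < N].
have := coef0 (m ord_max) => /mpolyP/(_ m0).
rewrite mcoeff0 muniE coef_sum raddf_sum /=.
have [mp|mp _] := boolP (m \in msupp p); last exact: memN_msupp_eq0.
rewrite (big_rem m) //= big1_seq ?addr0 => [|m' /andP[_]].
  by rewrite coefZ coefXn eqxx mulr1 mcoeffZ mcoeffX eqxx mulr1.
rewrite mem_rem_uniq ?msupp_uniq // inE => /andP[/eqP mm _].
rewrite coefZ coefXn; case: eqP => [em|_]; last by rewrite mulr0 mcoeff0.
rewrite mulr1 mcoeffZ mcoeffX; case: eqP => [e|_]; last by rewrite mulr0.
case: mm; apply/mnmP => i; have [j ->|->] := unliftP ord_max i; last by [].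
have -> : lift ord_max j = widen_ord (leqnSn N) j.
  by apply/val_inj; rewrite /= /bump leqNgt ltn_ord.
by move/mnmP/(_ j): e; rewrite !mnmE.
Qed.

(** * Generic points and dominant maps *)

Section Generic.
Variable R : realType.

Lemma mpoly_neq0_point N (p : {mpoly R[N]}) :
  p != 0 -> exists v : 'rV[R]_N, p.@[v 0] != 0.
Proof.
move=> p0; apply: contrapT => /forallNP h; move/eqP: p0; apply.
apply: mpoly_eval0 => v; apply/eqP/negPn/negP => hv.
apply: (h (\row_i v i)).
by rewrite (_ : p.@[_] = p.@[v]) //; apply: meval_eq => i; rewrite mxE.
Qed.

Lemma generic_mono N (P Q : 'rV[R]_N -> Prop) :
  (forall v, P v -> Q v) -> generic P -> generic Q.
Proof. by move=> PQ [q q0 hq]; exists q => // v /hq/PQ. Qed.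

Lemma generic_and N (P Q : 'rV[R]_N -> Prop) :
  generic P -> generic Q -> generic (fun v => P v /\ Q v).
Proof.
move=> [p p0 hp] [q q0 hq]; exists (p * q); first by rewrite mulf_neq0.
by move=> v; rewrite mevalM mulf_eq0 negb_or => /andP[/hp ? /hq].
Qed.

Section Subst.
Variables (N M : nat) (num : 'I_M -> {mpoly R[N]}) (den : {mpoly R[N]}).

Definition fracrow (v : 'rV[R]_N) : 'rV[R]_M :=
  \row_i ((num i).@[v 0] / den.@[v 0]).

(** The substitution of num / den in p, multiplied by den ^ k to clear its
    denominators; this is what [hsubstE] expresses, for k at least the degree
    of p. *)
Definition hsubst (k : nat) (p : {mpoly R[M]}) : {mpoly R[N]} :=
  \sum_(m <- msupp p) p@_m *: (\prod_i num i ^+ m i * den ^+ (k - mdeg m)).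

Lemma hsubstE k p (v : 'rV[R]_N) : den.@[v 0] != 0 -> (msize p <= k.+1)%N ->
  (hsubst k p).@[v 0] = p.@[fracrow v 0] * den.@[v 0] ^+ k.
Proof.
move=> d0 pk; rewrite /hsubst raddf_sum mevalE mulr_suml big_seq [RHS]big_seq.
apply: eq_bigr => m mp /=.
have mk : (mdeg m <= k)%N by have := msize_mdeg_lt mp; lia.
rewrite mevalZ rmorphM rmorphXn rmorph_prod /= -mulrA; congr (_ * _).
rewrite -[in RHS](subnKC mk) exprD mulrA; congr (_ * _).
rewrite mdegE -prodrXr -big_split /=; apply: eq_bigr => i _.
by rewrite rmorphXn mxE /= -exprMn divfK.
Qed.

End Subst.

Definition dominant N M (T : 'rV[R]_N -> option 'rV[R]_M) :=
  generic (fun w => exists v, T v = Some w).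

Lemma birational_dominant N (T : ratmap R N N) : birational T -> dominant T.
Proof.
move=> [S [_ h]]; apply: generic_mono h => w; rewrite /pcomp.
by case: (S w) => //= v hv; exists v.
Qed.

(** A nonzero polynomial q that detects Q pulls back, after clearing
    denominators, to a polynomial on the source.  Dominance makes it nonzero:
    some point of the image of T avoids the zeros of q. *)
Lemma generic_pullback N M (T : ratmap R N M) (Q : 'rV[R]_M -> Prop) :
  dominant T -> generic Q -> generic (fun v => exists2 w, T v = Some w & Q w).
Proof.
move=> domT [q q0 hq].
have TE (v : 'rV[R]_N) : (rm_den T).@[v 0] != 0 ->
    T v = Some (fracrow (rm_num T) (rm_den T) v).
  by move=> /negbTE d0; rewrite /ratmap_fun d0.
have qE (v : 'rV[R]_N) (d0 : (rm_den T).@[v 0] != 0) :=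
  @hsubstE _ _ (rm_num T) (rm_den T) (msize q) q v d0 (leqnSn _).
exists (hsubst (rm_num T) (rm_den T) (msize q) q * rm_den T).
  have [r r0 hr] := domT.
  have [w] := @mpoly_neq0_point _ (r * q) ltac:(by rewrite mulf_neq0).
  rewrite mevalM mulf_eq0 negb_or => /andP[/hr[v Tv] qw].
  apply/eqP => h0; have d0 : (rm_den T).@[v 0] != 0.
    by apply/negP => d0; move: Tv; rewrite /ratmap_fun d0.
  move/(congr1 (meval (v 0))): h0; rewrite mevalM meval0 qE //.
  move: Tv; rewrite TE // => -[->] /eqP.
  by rewrite !mulf_eq0 expf_eq0 (negbTE d0) (negbTE qw) andbF.
move=> v; rewrite mevalM mulf_eq0 negb_or => /andP[h d0].
eexists; first exact: TE.
by apply: hq; move: h; rewrite qE // mulf_eq0 negb_or => /andP[].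
Qed.

(** * Partial maps given locally by fractions *)

(** Composites of rational maps, computed as partial functions, belong to this
    class although they need not be the partial function of a single
    [ratmap]: the fraction may depend on the point v. *)
Definition locally_fraction N M (f : 'rV[R]_N -> option 'rV[R]_M) :=
  forall v, f v -> exists num den, den.@[v 0] != 0 /\
    forall w : 'rV[R]_N, den.@[w 0] != 0 -> f w = Some (fracrow num den w).

Lemma ratmap_locally_fraction N M (T : ratmap R N M) : locally_fraction T.
Proof.
move=> v; rewrite /ratmap_fun; case: ifPn => // d0 _.
by exists (rm_num T), (rm_den T); split=> // w /negbTE ->.
Qed.

Lemma pcomp_locally_fraction N M K (g : 'rV[R]_M -> option 'rV[R]_K)
    (f : 'rV[R]_N -> option 'rV[R]_M) :
  locally_fraction g -> locally_fraction f -> locally_fraction (pcomp g f).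
Proof.
move=> hg hf v; rewrite /pcomp; case fv: (f v) => [u|//] /= gu.
have [a [d [d0 fE]]] := hf v ltac:(by rewrite fv).
have [b [e [e0 gE]]] := hg u gu.
have uE : u = fracrow a d v by have := fE v d0; rewrite fv => -[].
pose k := maxn (msize e) (\max_i msize (b i)).
pose H := hsubst a d k.
have HE p (w : 'rV[R]_N) : d.@[w 0] != 0 -> (msize p <= k)%N ->
    (H p).@[w 0] = p.@[fracrow a d w 0] * d.@[w 0] ^+ k.
  by move=> dw pk; apply: hsubstE => //; apply: leqW.
have ek : (msize e <= k)%N by rewrite leq_maxl.
have bk i : (msize (b i) <= k)%N.
  by apply: leq_trans (leq_maxr _ _); apply: (leq_bigmax i).
(* The extra factor d makes the new denominator vanish wherever d does. *)
exists (fun i => H (b i) * d), (H e * d); split.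
  by rewrite mevalM mulf_neq0 // HE // mulf_neq0 ?expf_neq0 // -uE.
move=> w; rewrite mevalM mulf_eq0 negb_or => /andP[hw dw].
move: (hw); rewrite HE // mulf_eq0 negb_or => /andP[ew _].
rewrite fE //= gE //; congr Some; apply/rowP => i; rewrite [LHS]mxE [RHS]mxE.
rewrite !mevalM !HE // -2!(mulrA _ (_ ^+ k)) -mulf_div divff ?mulr1 //.
by rewrite mulf_neq0 ?expf_neq0.
Qed.

(** If a / d represents f near a point and b / e represents g there, generic
    agreement of f and g makes a * e - b * d vanish on a nonempty open set, so
    it is the zero polynomial and the two fractions agree at that point. *)
Lemma rational_eq_of_generic N M (f g : 'rV[R]_N -> option 'rV[R]_M) :
  locally_fraction f -> locally_fraction g ->
  generic (fun v => exists2 u, f v = Some u & g v = Some u) -> rational_eq f g.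
Proof.
move=> hf hg gen; split.
  by apply: generic_mono gen => v [u -> ->].
move=> v u w fv gv.
have [a [d [d0 fE]]] := hf v ltac:(by rewrite fv).
have [b [e [e0 gE]]] := hg v ltac:(by rewrite gv).
have [q q0 hq] := gen.
have d_neq0 : d != 0 by apply: contra d0 => /eqP ->; rewrite meval0.
have e_neq0 : e != 0 by apply: contra e0 => /eqP ->; rewrite meval0.
have agree (z : 'rV[R]_N) i : d.@[z 0] != 0 -> e.@[z 0] != 0 -> f z = g z ->
    (a i * e).@[z 0] = (b i * d).@[z 0].
  move=> dz ez; rewrite fE // gE // => -[] /rowP/(_ i); rewrite !mxE => /eqP.
  by rewrite eqr_div // -!mevalM => /eqP.
have cross i : a i * e = b i * d.
  apply/eqP; rewrite -subr_eq0; apply: contraT => h.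
  have [z] := @mpoly_neq0_point _ ((a i * e - b i * d) * (q * (d * e)))
    ltac:(by rewrite !mulf_neq0).
  rewrite !mevalM !mulf_eq0 !negb_or mevalB subr_eq0 => /and4P[/negP ne].
  by move=> /hq[t ft gt] dz ez; case: ne; rewrite (agree z i dz ez) // ft gt.
have: Some u = Some w; last by case.
rewrite -fv -gv fE // gE //; congr Some; apply/rowP => i; rewrite !mxE.
by apply/eqP; rewrite eqr_div // -!mevalM cross.
Qed.

(** * Acting on some of the coordinates *)

Section Lift.
Variables (K N : nat) (s : 'I_K -> 'I_N) (s_inj : injective s).

Definition gather (v : 'rV[R]_N) : 'rV[R]_K := \row_i v 0 (s i).

Definition scatter (v : 'rV[R]_N) (u : 'rV[R]_K) : 'rV[R]_N :=
  \row_j if [pick i | s i == j] is Some i then u 0 i else v 0 j.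

Lemma scatterE v u i : scatter v u 0 (s i) = u 0 i.
Proof.
rewrite mxE; case: pickP => [i' /eqP/s_inj -> //|/(_ i)].
by rewrite eqxx.
Qed.

Lemma scatter_out v u j : (forall i, s i != j) -> scatter v u 0 j = v 0 j.
Proof.
by move=> h; rewrite mxE; case: pickP => // i; rewrite (negbTE (h i)).
Qed.

Lemma scatter_gather v u : scatter (scatter v u) (gather v) = v.
Proof.
apply/rowP => j; rewrite mxE.
case: pickP => [i /eqP <-|h]; first by rewrite mxE.
by rewrite mxE; case: pickP => // i; rewrite h.
Qed.

Lemma gather_scatter v u : gather (scatter v u) = u.
Proof. by apply/rowP => i; rewrite mxE scatterE. Qed.

(** The common form of [R12 T] and [R23 T]. *)
Definition lift_map (T : 'rV[R]_K -> option 'rV[R]_K) (v : 'rV[R]_N) :=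
  omap (scatter v) (T (gather v)).

Definition rename (p : {mpoly R[K]}) : {mpoly R[N]} :=
  p \mPo [tuple 'X_(s i) | i < K].

Lemma renameE p (v : 'rV[R]_N) : (rename p).@[v 0] = p.@[gather v 0].
Proof.
rewrite comp_mpoly_meval; apply: meval_eq => i.
by rewrite tnth_mktuple mevalXU mxE.
Qed.

Lemma rename_neq0 p : p != 0 -> rename p != 0.
Proof.
move=> /mpoly_neq0_point[u pu]; apply: contra pu => /eqP r0.
by rewrite -(gather_scatter 0 u) -renameE r0 meval0.
Qed.

Lemma generic_gather (P : 'rV[R]_K -> Prop) :
  generic P -> generic (fun v => P (gather v)).
Proof.
move=> [q q0 hq]; exists (rename q); first exact: rename_neq0.
by move=> v; rewrite renameE => /hq.
Qed.

Lemma lift_ratmap (T : ratmap R K K) :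
  exists L : ratmap R N N, forall v, L v = lift_map T v.
Proof.
exists (RatMap
  (fun j => if [pick i | s i == j] is Some i then rename (rm_num T i)
            else 'X_j * rename (rm_den T)) (rename_neq0 (rm_den_neq0 T))).
move=> v; rewrite /lift_map /ratmap_fun /= renameE; case: ifPn => // d0 /=.
congr Some; apply/rowP => j; rewrite !mxE; case: pickP => [i _|_].
  by rewrite renameE mxE.
by rewrite mevalM mevalXU renameE mulfK.
Qed.

Lemma lift_dominant (T : 'rV[R]_K -> option 'rV[R]_K) :
  dominant T -> dominant (lift_map T).
Proof.
move=> /generic_gather; apply: generic_mono => w [u Tu].
exists (scatter w u).
by rewrite /lift_map gather_scatter Tu /= scatter_gather.
Qed.

End Lift.

End Generic.

(** * The entries of M(x,z) *)

Section MatrixM.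
Variables (R : realType) (n : nat) (n4 : (4 <= n)%N).
Implicit Types (x y : 'rV[R]_(dimB n)) (z : R).

Lemma prod_nat_neq0 (F : nat -> R) a b :
  (forall i, (a <= i < b)%N -> F i != 0) -> \prod_(a <= i < b) F i != 0.
Proof.
move=> F0; rewrite big_nat; apply: (big_ind (fun c => c != 0)) => //.
- exact: oner_neq0.
- by move=> c d c0 d0; rewrite mulf_neq0.
Qed.

Lemma prod_xv_neq0 x m : M_defined x -> (m <= n)%N ->
  \prod_(1 <= k < m.+1) xv x k != 0.
Proof. by move=> [hx _ _] mn; apply: prod_nat_neq0 => i hi; apply: hx; lia. Qed.

Lemma prod_xbar_neq0 x m : M_defined x -> (m <= n.-1)%N ->
  \prod_(1 <= k < m.+1) xbar x k != 0.
Proof. by move=> [_ hx _] mn; apply: prod_nat_neq0 => i hi; apply: hx; lia. Qed.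

Lemma level_neq0 x : M_defined x -> level x != 0.
Proof.
move=> hx; have -> : level x = (\prod_(1 <= k < n.+1) xv x k) *
  (\prod_(1 <= k < n.-1.+1) xbar x k) by rewrite prednK //; lia.
by rewrite mulf_neq0 ?prod_xv_neq0 ?prod_xbar_neq0.
Qed.

Lemma Mcol1_1 x : Mcol1 x 1 = xv x 1 / xbar x 1.
Proof. by []. Qed.

Lemma Mcol1_low x i : (2 <= i <= n.-1)%N ->
  Mcol1 x i = (\prod_(1 <= k < i) xv x k) * (1 + xv x i / xbar x i).
Proof.
move=> hi; rewrite /Mcol1 ifF; last by apply/negbTE; lia.
by rewrite ifT //; lia.
Qed.

Lemma Mcol1_n x : Mcol1 x n = \prod_(1 <= k < n.+1) xv x k.
Proof.
rewrite /Mcol1 ifF; last by apply/negbTE; lia.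
by rewrite ifF ?eqxx //; apply/negbTE; lia.
Qed.

Lemma Mcol1_n1 x : Mcol1 x n.+1 = \prod_(1 <= k < n) xv x k.
Proof.
rewrite /Mcol1 ifF; last by apply/negbTE; lia.
rewrite ifF; last by apply/negbTE; lia.
by rewrite ifF ?eqxx //; apply/negbTE; lia.
Qed.

Lemma Mcol1_high x j : (j <= n - 2)%N ->
  Mcol1 x (2 * n - j) = level x / \prod_(1 <= k < j.+1) xbar x k.
Proof.
move=> hj; rewrite /Mcol1; do 4! [rewrite ifF; last by apply/negbTE; lia].
by have -> : (2 * n - (2 * n - j) = j)%N by lia.
Qed.

Lemma Mcol1_last x : Mcol1 x (2 * n) = level x.
Proof. by have := @Mcol1_high x 0; rewrite subn0 big_geq // divr1 => ->. Qed.

Let delta (i j : nat) : R := (i == j)%:R.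

Lemma MleftS x z j i : (1 <= j)%N ->
  Mleft x z j.+1 i = Mleft x z j i / xv x j +
    (level x * z - 1) * (delta i j / xbar x j + delta i j.+1).
Proof. by case: j. Qed.

Lemma MrightS x z j i : (1 <= j)%N ->
  Mright x z j.+1 i =
      xbar x j.+1 * (Xbar x j.+2 / Xbar x j.+1) * Mright x z j i
      + (1 - level x * z)
        * (delta i (2 * n + 1 - j.+1) * xbar x j.+1 *
             (Xbar x j.+2 / Xbar x j.+1)
           + delta i (2 * n - j.+1) * (xbar x j.+2 / xv x j.+2)).
Proof. by case: j. Qed.

Lemma MentryL x z i j : (j <= n.-1)%N -> Mentry x z i j = Mleft x z j i.
Proof. by rewrite /Mentry => ->. Qed.

Lemma Mentry_n x z i : Mentry x z i n = Mcoln x z i.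
Proof. by rewrite /Mentry ifF ?eqxx //; apply/negbTE; lia. Qed.

Lemma Mentry_n1 x z i : Mentry x z i n.+1 = Mcoln1 x z i.
Proof.
rewrite /Mentry ifF; last by apply/negbTE; lia.
by rewrite ifF ?eqxx //; apply/negbTE; lia.
Qed.

Lemma MentryR x z i j : (j <= n - 2)%N ->
  Mentry x z i (2 * n - j) = Mright x z j i.
Proof.
move=> hj; rewrite /Mentry; do 3! [rewrite ifF; last by apply/negbTE; lia].
by have -> : (2 * n - (2 * n - j) = j)%N by lia.
Qed.

Lemma Mentry1 x z i : Mentry x z i 1 = Mcol1 x i.
Proof. by rewrite MentryL //; lia. Qed.

(** Columns are numbered here as in the definition of [Mentry]: from the left
    up to n-1, the two middle ones, and from the right. *)
Lemma column_cases (P : nat -> Prop) :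
  (forall j, (1 <= j <= n.-1)%N -> P j) -> P n -> P n.+1 ->
  (forall j, (j <= n - 2)%N -> P (2 * n - j)%N) ->
  forall j, (1 <= j <= 2 * n)%N -> P j.
Proof.
move=> h1 h2 h3 h4 j hj.
have [jn|jn] := leqP j n.-1; first by apply: h1; lia.
have [->|jn'] := eqVneq j n; first exact: h2.
have [->|jn''] := eqVneq j n.+1; first exact: h3.
have -> : j = (2 * n - (2 * n - j))%N by lia.
by apply: h4; lia.
Qed.

(** * Rank one at the reciprocal of the level *)

Definition proportional (a b : nat -> R) := exists c, forall i, a i = b i * c.

(** In each recursion between columns, the terms that are not multiples of the
    previous column or of the first one carry a factor level x * z - 1. *)
Lemma Mentry_rank1 x z j : level x * z = 1 -> (1 <= j <= 2 * n)%N ->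
  proportional (fun i => Mentry x z i j) (Mcol1 x).
Proof.
move=> lz.
have lz0 : level x * z - 1 = 0 by rewrite lz subrr.
have zl0 : 1 - level x * z = 0 by rewrite lz subrr.
have left k : proportional (Mleft x z k.+1) (Mcol1 x).
  elim: k => [|k [c hc]]; first by exists 1 => i; rewrite mulr1.
  by exists (c / xv x k.+1) => i; rewrite MleftS // hc lz0 mul0r addr0 mulrA.
have lft k : (1 <= k)%N -> proportional (Mleft x z k) (Mcol1 x).
  by case: k => // k _; apply: left.
have right k : proportional (Mright x z k) (Mcol1 x).
  elim: k => [|k [c hc]].
    by exists (z * (xbar x 1 / xv x 1)) => i /=; rewrite lz0 zl0; ring.
  case: k c hc => [|k] c hc.
    by exists (z * xbar x 1 * Xbar x 2) => i /=; rewrite zl0; ring.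
  exists (xbar x k.+2 * (Xbar x k.+3 / Xbar x k.+2) * c) => i.
  by rewrite MrightS // hc zl0; ring.
have n0 : (0 < n.-1)%N by lia.
move: j; apply: column_cases => [j hj|||j hj].
- have [c hc] := lft j ltac:(lia).
  by exists c => i; rewrite MentryL ?hc //; lia.
- have [c hc] := lft _ n0.
  exists (c / xv x n.-1) => i.
  by rewrite Mentry_n /Mcoln hc lz0 mul0r addr0 mulrA.
- have [c hc] := lft _ n0.
  exists (c / (xv x n.-1 * xv x n)) => i.
  by rewrite Mentry_n1 /Mcoln1 hc lz0 mul0r addr0 mulrA.
- have [c hc] := right j.
  by exists c => i; rewrite MentryR ?hc //.
Qed.

Definition Mcol1v x : 'cV[R]_(2 * n) := \col_i Mcol1 x i.+1.

(** The row c is nonzero because the bottom left entry of the matrix is the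
    level. *)
Lemma Mmx_rank1 x z : level x * z = 1 ->
  exists2 c : 'rV[R]_(2 * n), c != 0 & Mmx x z = Mcol1v x *m c.
Proof.
move=> lz.
have /fin_all_exists[c hc] (j : 'I_(2 * n)) :
    exists c, forall i, Mentry x z i j.+1 = Mcol1 x i * c.
  by apply: Mentry_rank1 => //; have := ltn_ord j; lia.
have E : Mmx x z = Mcol1v x *m \row_j c j.
  by apply/matrixP=> i j; rewrite !mxE big_ord1 !mxE hc.
exists (\row_j c j) => //.
have l0 : level x != 0.
  by apply: contra_eq_neq lz => ->; rewrite mul0r eq_sym oner_neq0.
have h1 : (0 < 2 * n)%N by lia.
have h2 : ((2 * n).-1 < 2 * n)%N by lia.
apply/eqP => c0.
have /(congr1 (fun A : 'M_(2 * n) => A (Ordinal h2) (Ordinal h1))) := E.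
rewrite c0 mulmx0 !mxE /= Mentry1 prednK // Mcol1_last => /eqP.
exact/negP.
Qed.

(** * Recovering x from the first column *)

(** The entries in rows n+2, ..., 2n give the partial products of the xbar_i,
    those in rows n and n+1 give x_1 ... x_n and x_1 ... x_{n-1}, and the
    entries in rows 1, ..., n-1 then give the x_i one after the other. *)
Lemma Mcol1_inj x y : M_defined x -> M_defined y -> level x = level y ->
  (forall i, (1 <= i <= 2 * n)%N -> Mcol1 x i = Mcol1 y i) -> x = y.
Proof.
move=> hx hy hl hM.
have hX0 := prod_xv_neq0 hx; have hX1 := prod_xbar_neq0 hx.
have l0 := level_neq0 hx.
have ratio (a b : nat -> R) m : \prod_(1 <= k < m.+1) a k != 0 ->
    \prod_(1 <= k < m.+1) a k = \prod_(1 <= k < m.+1) b k ->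
    \prod_(1 <= k < m.+2) a k = \prod_(1 <= k < m.+2) b k ->
    a m.+1 = b m.+1.
  move=> a0 ea; rewrite (big_nat_recr m.+1) //= (big_nat_recr m.+1) //= -ea.
  exact: mulfI.
have pX : \prod_(1 <= k < n.+1) xv x k = \prod_(1 <= k < n.+1) xv y k.
  by rewrite -!Mcol1_n hM //; lia.
have pX1 : \prod_(1 <= k < n) xv x k = \prod_(1 <= k < n) xv y k.
  by rewrite -!Mcol1_n1 hM //; lia.
have pB m : (m <= n.-1)%N ->
    \prod_(1 <= k < m.+1) xbar x k = \prod_(1 <= k < m.+1) xbar y k.
  move=> hm; have [hm2|hm2] := leqP m (n - 2).
    have := @hM (2 * n - m)%N; rewrite !Mcol1_high // -hl => /(_ ltac:(lia)).
    by move/(mulfI l0)/invr_inj.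
  (* For m = n-1 the product is the level divided by x_1 ... x_n. *)
  have -> : m = n.-1 by lia.
  rewrite prednK; last by lia.
  by move: hl; rewrite /level -pX; apply: mulfI; apply: hX0.
have eB m : (1 <= m <= n.-1)%N -> xbar x m = xbar y m.
  case: m => // m hm; apply: ratio; [apply: hX1|apply: pB|apply: pB]; lia.
have eV m : (1 <= m <= n.-1)%N -> xv x m = xv y m.
  elim/ltn_ind: m => m IH hm.
  have bm : xbar x m != 0 by case: hx => _ h _; apply: h.
  have [m1|m1] := eqVneq m 1%N.
    have := @hM 1%N ltac:(lia); rewrite !Mcol1_1 m1 -eB; last by lia.
    by apply: mulIf; rewrite invr_eq0 -m1.
  have := @hM m ltac:(lia); rewrite !Mcol1_low; try lia.
  have -> : \prod_(1 <= k < m) xv y k = \prod_(1 <= k < m) xv x k.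
    by apply: eq_big_nat => k hk; rewrite IH //; lia.
  have p0 : \prod_(1 <= k < m) xv x k != 0.
    by have := hX0 m.-1 ltac:(lia); rewrite prednK //; lia.
  move/(mulfI p0)/addrI; rewrite -eB //.
  by apply: mulIf; rewrite invr_eq0.
(* Stated for m = n because n also occurs in the type of x. *)
have eVn m : m = n -> xv x m = xv y m.
  case: m => [|m] mn; first by lia.
  apply: ratio; first by apply: hX0; lia.
    by rewrite mn.
  by rewrite mn.
have cE (u : 'rV[R]_(dimB n)) (k : 'I_(dimB n)) : u 0 k = Defs.coord u k.
  by rewrite /Defs.coord valK.
apply/rowP => k; rewrite !cE.
have hk : (k < (2 * n).-1)%N by [].
have [kn|kn] := ltnP k n.
  suff: xv x k.+1 = xv y k.+1 by [].
  have [/eVn//|k1] := eqVneq k.+1 n.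
  by apply: eV; lia.
have kE : nat_of_ord k = ((2 * n).-1 - ((2 * n).-1 - k))%N by lia.
by rewrite kE; apply: eB; lia.
Qed.

(** * Invertibility away from the reciprocal of the level *)

(** Let u be a row vector with u M(x,z) = 0, and U its entries.  Dividing the
    recursions between columns by level x * z - 1 gives relations that express
    every entry of u through U 1.  In the remaining equation, u times the first
    column, the sum telescopes: with q_m = x_1 ... x_m / (xbar_1 ... xbar_m),
    each term of index 2 <= i <= n-1 is a multiple of q_{i-1} + q_i with
    alternating signs, and likewise for the rows n+2 <= i < 2n.  What is left is
    (level x * z - 1) q_{n-1} U 1 up to sign, hence U 1 = 0. *)
Lemma Mmx_unit x z : M_defined x -> level x * z != 1 -> Mmx x z \in unitmx.
Proof.
move=> hx lz1; rewrite -row_free_unit -kermx_eq0; apply/rowV0P => u.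
move/sub_kermxP => uM.
pose U k := Defs.coord u k.-1.
pose S (f : nat -> R) := \sum_(1 <= i < (2 * n).+1) U i * f i.
have SM j : (1 <= j <= 2 * n)%N -> S (fun i => Mentry x z i j) = 0.
  move=> hj; have hj' : (j.-1 < 2 * n)%N by lia.
  move/rowP/(_ (Ordinal hj')): uM; rewrite !mxE => h; rewrite -[RHS]h /S.
  rewrite big_add1 big_mkord; apply: eq_bigr => i _.
  by rewrite !mxE /= prednK ?(proj1 (andP hj)) // /U /Defs.coord /= valK.
have Slin a b f g : S (fun i => a * f i + b * g i) = a * S f + b * S g.
  rewrite /S !big_distrr -big_split /=; apply: eq_bigr => i _; ring.
have Sext f g : (forall i, f i = g i) -> S f = S g.
  by move=> fg; apply: eq_bigr => i _; rewrite fg.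
have Sdelta k : (1 <= k <= 2 * n)%N -> S (fun i => delta i k) = U k.
  move=> hk; rewrite /S (big_rem k) /=; last by rewrite mem_index_iota; lia.
  rewrite /delta eqxx mulr1 big1_seq ?addr0 // => i /andP[_].
  rewrite mem_rem_uniq ?iota_uniq // inE => /andP[/negbTE -> _].
  by rewrite mulr0.
have l1 : level x * z - 1 != 0 by rewrite subr_eq0.
have l1' : 1 - level x * z != 0 by rewrite subr_eq0 eq_sym.
have [hv hb hB] := hx.
have S1 : S (Mcol1 x) = 0.
  by have := SM 1%N; under Sext => i do rewrite Mentry1; apply; lia.
have SL j : (1 <= j <= n.-1)%N -> S (Mleft x z j) = 0.
  move=> hj; rewrite -(SM j); last by lia.
  by apply: Sext => i; rewrite MentryL //; lia.
have SR j : (j <= n - 2)%N -> S (Mright x z j) = 0.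
  move=> hj; rewrite -(SM (2 * n - j)%N); last by lia.
  by apply: Sext => i; rewrite MentryR //; lia.
(* The equation carried by the terms that a column recursion adds to a
   multiple of a column already annihilated by u. *)
have kill f g c d : S f = 0 -> S g = 0 -> d != 0 ->
  forall h, (forall i, f i = c * g i + d * h i) -> S h = 0.
  move=> Sf Sg d0 h fE; move: Sf; rewrite (Sext _ _ fE) Slin Sg mulr0 add0r.
  by move/eqP; rewrite mulf_eq0 (negbTE d0) => /eqP.
have UL j : (1 <= j <= n - 2)%N -> U j.+1 = - (U j / xbar x j).
  move=> hj.
  have := kill _ _ (xv x j)^-1 _ (SL j.+1 ltac:(lia)) (SL j ltac:(lia)) l1
   (fun i => (xbar x j)^-1 * delta i j + 1 * delta i j.+1).
  rewrite Slin !Sdelta; try lia; move=> h.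
  apply/eqP; rewrite -addr_eq0; apply/eqP; rewrite -[RHS]h; first by ring.
  by move=> i; rewrite MleftS; [ring|lia].
have Un1 : U n.+1 = - (U n.-1 / xbar x n.-1).
  have := kill _ _ (xv x n.-1)^-1 _ (SM n ltac:(lia)) (SL n.-1 ltac:(lia)) l1
   (fun i => (xbar x n.-1)^-1 * delta i n.-1 + 1 * delta i n.+1).
  rewrite Slin !Sdelta; try lia; move=> h.
  apply/eqP; rewrite -addr_eq0; apply/eqP; rewrite -[RHS]h; first by ring.
  by move=> i; rewrite Mentry_n /Mcoln /delta; ring.
have Un : U n = - (U n.-1 / (xbar x n.-1 * xv x n)).
  have := kill _ _ (xv x n.-1 * xv x n)^-1 _ (SM n.+1 ltac:(lia))
    (SL n.-1 ltac:(lia)) l1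
   (fun i => (xbar x n.-1 * xv x n)^-1 * delta i n.-1 + 1 * delta i n).
  rewrite Slin !Sdelta; try lia; move=> h.
  apply/eqP; rewrite -addr_eq0; apply/eqP; rewrite -[RHS]h; first by ring.
  by move=> i; rewrite Mentry_n1 /Mcoln1 /delta; ring.
have v1 : xv x 1 != 0 by apply: hv; lia.
have b1 : xbar x 1 != 0 by apply: hb; lia.
have U2n : U (2 * n) = z * (xv x 1 / xbar x 1) * U 1%N.
  have := kill _ _ (z * (xbar x 1 / xv x 1)) _ (SR 0 ltac:(lia)) S1 l1'
   (fun i => (xbar x 1 / xv x 1) * delta i (2 * n) + (- z) * delta i 1).
  rewrite Slin !Sdelta; try lia; move=> h.
  have {h}/eqP : xbar x 1 / xv x 1 * U (2 * n)%N + - z * U 1%N = 0.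
    by apply: h => i /=; rewrite /delta; ring.
  rewrite mulNr subr_eq0 => /eqP h.
  transitivity ((xv x 1 / xbar x 1) * (xbar x 1 / xv x 1 * U (2 * n)%N)).
    by field; rewrite v1.
  by rewrite h; ring.
have UR1 : U (2 * n - 1)%N =
    - (U (2 * n)%N * xbar x 1 * Xbar x 2 * (xv x 2 / xbar x 2)).
  have v2 : xv x 2 != 0 by apply: hv; lia.
  have b2 : xbar x 2 != 0 by apply: hb; lia.
  have := kill _ _ (z * xbar x 1 * Xbar x 2) _ (SR 1%N ltac:(lia)) S1 l1'
   (fun i => (xbar x 1 * Xbar x 2) * delta i (2 * n) +
             (xbar x 2 / xv x 2) * delta i (2 * n - 1)).
  rewrite Slin !Sdelta; try lia; move=> h.
  have {h}/eqP : xbar x 1 * Xbar x 2 * U (2 * n)%N +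
       xbar x 2 / xv x 2 * U (2 * n - 1)%N = 0.
    by apply: h => i /=; rewrite /delta; ring.
  rewrite addrC addr_eq0 => /eqP h.
  transitivity ((xv x 2 / xbar x 2) * (xbar x 2 / xv x 2 * U (2 * n - 1)%N)).
    by field; rewrite v2.
  by rewrite h; ring.
have URS j : (2 <= j <= n - 2)%N -> U (2 * n - j)%N =
    - (U (2 * n - j.-1)%N * xbar x j * (Xbar x j.+1 / Xbar x j) *
       (xv x j.+1 / xbar x j.+1)).
  case: j => // j hj.
  have v2 : xv x j.+2 != 0 by apply: hv; lia.
  have b2 : xbar x j.+2 != 0 by apply: hb; lia.
  have := kill _ _ (xbar x j.+1 * (Xbar x j.+2 / Xbar x j.+1)) _
    (SR j.+1 ltac:(lia)) (SR j ltac:(lia)) l1'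
   (fun i => (xbar x j.+1 * (Xbar x j.+2 / Xbar x j.+1)) * delta i (2 * n - j)
     + (xbar x j.+2 / xv x j.+2) * delta i (2 * n - j.+1)).
  rewrite Slin !Sdelta; try lia; move=> h.
  have {h}/eqP : xbar x j.+1 * (Xbar x j.+2 / Xbar x j.+1) * U (2 * n - j)%N +
       xbar x j.+2 / xv x j.+2 * U (2 * n - j.+1)%N = 0.
    apply: h => i; rewrite MrightS; last by lia.
    have -> : (2 * n + 1 - j.+1 = 2 * n - j)%N by lia.
    by rewrite /delta; ring.
  rewrite addrC addr_eq0 => /eqP h.
  transitivity ((xv x j.+2 / xbar x j.+2) *
     (xbar x j.+2 / xv x j.+2 * U (2 * n - j.+1)%N)).
    by field; rewrite v2.
  by rewrite h /=; ring.
(* p m is (-1)^m q_{m+1} in the notation above the lemma; AL and BR evaluate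
   the partial sums of u times the first column from the top and from the
   bottom. *)
pose p m := (-1) ^+ m * \prod_(1 <= k < m.+2) (xv x k / xbar x k).
have pS m : p m.+1 = - (p m * (xv x m.+2 / xbar x m.+2)).
  by rewrite /p (big_nat_recr m.+2) //= exprS; ring.
have ULE m : (m <= n - 2)%N ->
    U m.+1 * (\prod_(1 <= k < m.+2) xv x k) / xbar x m.+1 = p m * U 1%N.
  elim: m => [|m IH] hm.
    by rewrite /p !big_nat1 expr0; ring.
  rewrite pS (big_nat_recr m.+2) //= UL; last by lia.
  transitivity (- (U m.+1 * (\prod_(1 <= k < m.+2) xv x k) / xbar x m.+1) *
    (xv x m.+2 / xbar x m.+2)); first by ring.
  by rewrite IH; [ring|lia].
have AL m : (m <= n - 2)%N ->
    \sum_(1 <= i < m.+2) U i * Mcol1 x i = p m * U 1%N.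
  elim: m => [|m IH] hm.
    by rewrite /p !big_nat1 expr0 Mcol1_1; ring.
  rewrite big_nat_recr //= IH; last by lia.
  rewrite Mcol1_low; last by lia.
  rewrite -(ULE m.+1) // -(ULE m); last by lia.
  rewrite (big_nat_recr m.+2) //= (UL m.+1); last by lia.
  by ring.
have URE j : (1 <= j <= n - 2)%N -> U (2 * n - j)%N =
    z * p j * (\prod_(1 <= k < j.+1) xbar x k) * Xbar x j.+1 * U 1%N.
  elim: j => // j IH hj; case: j IH hj => [|j] IH hj.
    by rewrite UR1 U2n pS /p !big_nat1 expr0; ring.
  rewrite URS // IH; last by lia.
  rewrite [in RHS]pS [in RHS]big_nat_recr //=.
  have B0 : Xbar x j.+2 != 0 by apply: hB; lia.
  have b0 : xbar x j.+3 != 0 by apply: hb; lia.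
  by field; rewrite B0 b0.
have BR j : (j <= n - 2)%N ->
    \sum_(2 * n - j <= i < (2 * n).+1) U i * Mcol1 x i =
    level x * z * p j * U 1%N.
  elim: j => [|j IH] hj.
    by rewrite subn0 big_nat1 Mcol1_last U2n /p big_nat1 expr0; ring.
  rewrite big_ltn; last by lia.
  have -> : ((2 * n - j.+1).+1 = 2 * n - j)%N by lia.
  rewrite IH; last by lia.
  rewrite Mcol1_high // URE //.
  have B0 : \prod_(1 <= k < j.+2) xbar x k != 0.
    by apply: prod_xbar_neq0 => //; lia.
  have b0 : xbar x j.+2 != 0 by apply: hb; lia.
  have v0 : xv x j.+2 != 0 by apply: hv; lia.
  by rewrite pS /Xbar; field; rewrite b0 v0 B0.
have nE : (n - 2).+2 = n by lia.
have pn : p (n - 2)%N * U 1%N = 0.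
  have := S1; rewrite /S (@big_cat_nat _ _ _ n) /=; try lia.
  rewrite [X in _ + X]big_ltn; last by lia.
  rewrite [X in _ + (_ + X)]big_ltn; last by lia.
  have := AL _ (leqnn _); rewrite nE => ->.
  have := BR _ (leqnn _); have -> : (2 * n - (n - 2) = n.+2)%N by lia.
  move=> ->; rewrite Mcol1_n Mcol1_n1 Un Un1 => h.
  have := ULE _ (leqnn _); rewrite nE; have -> : (n - 2).+1 = n.-1 by lia.
  move=> h2; have vn : xv x n != 0 by apply: hv; lia.
  have bn : xbar x n.-1 != 0 by apply: hb; lia.
  move: h; rewrite (big_nat_recr n) /=; last by lia.
  have -> : - (U n.-1 / (xbar x n.-1 * xv x n)) *
     (\prod_(1 <= i < n) xv x i * xv x n) =
     - (U n.-1 * \prod_(1 <= k < n) xv x k / xbar x n.-1).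
    by field; rewrite bn vn.
  have -> : - (U n.-1 / xbar x n.-1) * \prod_(1 <= k < n) xv x k =
     - (U n.-1 * \prod_(1 <= k < n) xv x k / xbar x n.-1) by ring.
  rewrite h2 => h; apply: (mulfI l1); rewrite mulr0 -[RHS]h; ring.
have U1 : U 1%N = 0.
  have r0 : \prod_(1 <= k < n) (xv x k / xbar x k) != 0.
    apply: prod_nat_neq0 => i hi.
    by rewrite mulf_neq0 ?invr_eq0 ?hv ?hb //; lia.
  move/eqP: pn; rewrite /p nE !mulf_eq0 signr_eq0 (negbTE r0) /=.
  by move/eqP.
have U0 : forall j, (1 <= j <= 2 * n)%N -> U j = 0.
  have Ul j : (1 <= j <= n.-1)%N -> U j = 0.
    elim: j => // -[_ _ //|j IH] hj.
    by rewrite UL ?IH ?mul0r ?oppr0 //; lia.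
  apply: column_cases => // [||j hj].
  - by rewrite Un Ul ?mul0r ?oppr0 //; lia.
  - by rewrite Un1 Ul ?mul0r ?oppr0 //; lia.
  - case: j hj => [|j] hj; first by rewrite subn0 U2n U1 mulr0.
    by rewrite URE // U1 mulr0.
apply/rowP => i; rewrite mxE.
have := U0 i.+1 ltac:(by have := ltn_ord i; lia).
by rewrite /U /Defs.coord /= valK.
Qed.

(** * Uniqueness of factorizations *)

(** Both sides have rank one, so their columns span the same line; comparing
    the last entries of the first columns, which are the levels, shows that
    these columns are equal and not merely proportional. *)
Lemma Mmx_head_uniq x y z (N N' : 'M[R]_(2 * n)) :
  M_defined x -> M_defined y -> level x = level y -> level x * z = 1 ->
  N \in unitmx -> Mmx x z *m N = Mmx y z *m N' -> x = y.
Proof.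
move=> hx hy hl lz uN E; have l0 := level_neq0 hx.
have [c c0 hc] := Mmx_rank1 lz.
have [c' _ hc'] := @Mmx_rank1 y z ltac:(by rewrite -hl).
rewrite hc hc' -!mulmxA in E.
have Eij i j : (1 <= i <= 2 * n)%N ->
    Mcol1 x i * (c *m N) 0 j = Mcol1 y i * (c' *m N') 0 j.
  move=> hi; have hi' : (i.-1 < 2 * n)%N by lia.
  move/matrixP/(_ (Ordinal hi') j): E.
  rewrite 2![(Mcol1v _ *m _) _ _]mxE !big_ord1 ![Mcol1v _ _ _]mxE /=.
  by rewrite prednK //; lia.
have /rV0Pn[j cj] : c *m N != 0.
  apply: contra c0 => /eqP h.
  by rewrite -(mulmxK uN c) h mul0mx.
apply: Mcol1_inj => // i hi.
have := Eij (2 * n)%N j ltac:(lia); rewrite !Mcol1_last -hl => /(mulfI l0) e.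
by have := Eij i j hi; rewrite -e => /(mulIf cj).
Qed.

(** Peel off the factors from the left: at the reciprocal of the level of x_i
    the i-th factor has rank one while all others are invertible. *)
Lemma factorization3_uniq x1 x2 x3 y1 y2 y3 :
  M_defined x1 -> M_defined x2 -> M_defined x3 ->
  M_defined y1 -> M_defined y2 -> M_defined y3 ->
  level x1 = level y1 -> level x2 = level y2 -> level x3 = level y3 ->
  level x1 != level x2 -> level x1 != level x3 -> level x2 != level x3 ->
  (forall z, Mmx x1 z *m Mmx x2 z *m Mmx x3 z =
             Mmx y1 z *m Mmx y2 z *m Mmx y3 z) ->
  [/\ x1 = y1, x2 = y2 & x3 = y3].
Proof.
move=> dx1 dx2 dx3 dy1 dy2 dy3 l1 l2 l3 n12 n13 n23 E.
have unitM (a b : 'rV[R]_(dimB n)) :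
    M_defined a -> M_defined b -> level a != level b ->
    Mmx a (level b)^-1 \in unitmx.
  move=> da db ab; apply: Mmx_unit => //; apply: contra ab => /eqP h.
  apply/eqP; rewrite -[LHS]mulr1 -(mulVf (level_neq0 db)) mulrA h mul1r //.
have lV (a : 'rV[R]_(dimB n)) : M_defined a -> level a * (level a)^-1 = 1.
  by move=> da; rewrite mulfV // level_neq0.
have e1 : x1 = y1.
  apply: (@Mmx_head_uniq x1 y1 (level x1)^-1
    (Mmx x2 (level x1)^-1 *m Mmx x3 (level x1)^-1)) => //.
  - exact: lV.
  - by rewrite unitmx_mul !unitM // eq_sym.
  - by rewrite mulmxA E -mulmxA.
subst y1.
have e2 : x2 = y2.
  apply: (@Mmx_head_uniq x2 y2 (level x2)^-1 (Mmx x3 (level x2)^-1)) => //.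
  - exact: lV.
  - by rewrite unitM // eq_sym.
  - have := E (level x2)^-1; rewrite -!mulmxA; apply: can_inj.
    by apply: mulKmx; apply: unitM.
subst y2; split=> //.
apply: (@Mmx_head_uniq x3 y3 (level x3)^-1 1%:M 1%:M) => //.
- exact: lV.
- exact: unitmx1.
- rewrite !mulmx1; have := E (level x3)^-1; apply: can_inj.
  by apply: mulKmx; rewrite unitmx_mul !unitM.
Qed.

End MatrixM.

(** * The maps R12 and R23 on triples *)

Section YangBaxter.
Variable R : realType.

Section Positions.
Variable d : nat.

Definition pos12 : 'I_(d + d) -> 'I_(d + d + d) := lshift d.

Definition pos23 (i : 'I_(d + d)) : 'I_(d + d + d) :=
  match split i with
  | inl a => lshift d (rshift d a)
  | inr b => rshift (d + d) b
  end.

Lemma pos12_inj : injective pos12.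
Proof. exact: lshift_inj. Qed.

Lemma gather_pos12 (t : 'rV[R]_(d + d + d)) : gather pos12 t = lsubmx t.
Proof. by apply/rowP => i; rewrite !mxE. Qed.

Lemma pos23l a : pos23 (lshift d a) = lshift d (rshift d a).
Proof. by rewrite /pos23 (unsplitK (inl _)). Qed.

Lemma pos23r a : pos23 (rshift d a) = rshift (d + d) a.
Proof. by rewrite /pos23 (unsplitK (inr _)). Qed.

Lemma pos23_inj : injective pos23.
Proof.
move=> i j; case: (split_ordP i) => a ->; case: (split_ordP j) => b ->;
  rewrite ?pos23l ?pos23r.
- by move=> /lshift_inj/rshift_inj ->.
- by move/eqP; rewrite eq_lrshift.
- by move/eqP; rewrite eq_rlshift.
- by move=> /rshift_inj ->.
Qed.

Lemma gather_pos23 (t : 'rV[R]_(d + d + d)) :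
  gather pos23 t = row_mx (rsubmx (lsubmx t)) (rsubmx t).
Proof.
apply/rowP => i; rewrite mxE; case: (split_ordP i) => a ->.
  by rewrite pos23l row_mxEl !mxE.
by rewrite pos23r row_mxEr !mxE.
Qed.

Lemma R12_lift (T : ratmap R (d + d) (d + d)) t : R12 T t = lift_map pos12 T t.
Proof.
rewrite /R12 /lift_map gather_pos12.
case: (T _) => //= p; congr Some; apply/rowP => j.
case: (split_ordP j) => i ->; first by rewrite row_mxEl (scatterE pos12_inj).
rewrite row_mxEr scatter_out ?mxE // => i'.
by rewrite eq_lrshift.
Qed.

Lemma R23_lift (T : ratmap R (d + d) (d + d)) t : R23 T t = lift_map pos23 T t.
Proof.
rewrite /R23 /lift_map gather_pos23.
case: (T _) => //= p; congr Some; apply/rowP => j.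
case: (split_ordP j) => i ->; last first.
  by rewrite row_mxEr -pos23r (scatterE pos23_inj) mxE.
rewrite row_mxEl; case: (split_ordP i) => a ->; last first.
  by rewrite row_mxEr -pos23l (scatterE pos23_inj) mxE.
rewrite row_mxEl scatter_out ?mxE // => k.
case: (split_ordP k) => b ->; rewrite ?pos23l ?pos23r ?eq_rlshift //.
by rewrite (inj_eq (@lshift_inj _ _)) eq_rlshift.
Qed.

End Positions.

Section LiftedMaps.
Variables (d : nat) (T : ratmap R (d + d) (d + d)).

Lemma R12_ratmap : exists L : ratmap R (d + d + d) (d + d + d), L =1 R12 T.
Proof.
have [L hL] := lift_ratmap (@pos12_inj d) T.
by exists L => t; rewrite hL R12_lift.
Qed.

Lemma R23_ratmap : exists L : ratmap R (d + d + d) (d + d + d), L =1 R23 T.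
Proof.
have [L hL] := lift_ratmap (@pos23_inj d) T.
by exists L => t; rewrite hL R23_lift.
Qed.

Lemma R12_dominant : birational T -> dominant (R12 T).
Proof.
move=> /birational_dominant/(lift_dominant (@pos12_inj d)).
by apply: generic_mono => w [v hv]; exists v; rewrite R12_lift.
Qed.

Lemma R23_dominant : birational T -> dominant (R23 T).
Proof.
move=> /birational_dominant/(lift_dominant (@pos23_inj d)).
by apply: generic_mono => w [v hv]; exists v; rewrite R23_lift.
Qed.

End LiftedMaps.

(** * The braid relation *)

(** The first three relations trace R12, R23, R12 and the last three trace R23,
    R12, R23.  The distinctness of the levels is contained in the relations
    themselves, as every pair of levels is exchanged once. *)
Lemma refactors_braid n x1 x2 x3 a b c e f g a' b' c' e' f' g' : (4 <= n)%N ->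
  @refactors R n x1 x2 a b -> refactors b x3 c e -> refactors a c f g ->
  refactors x2 x3 a' b' -> refactors x1 a' c' e' -> refactors e' b' f' g' ->
  [/\ f = c', g = f' & e = g'].
Proof.
move=> n4 [da db E1 [p1 p2 p3]] [dc de E2 [p4 p5 p6]] [df dg E3 [p7 p8 p9]].
move=> [da' db' F1 [q1 q2 q3]] [dc' de' F2 [q4 q5 q6]] [df' dg' F3 [q7 q8 q9]].
apply: (factorization3_uniq n4) => //; try congruence.
- by rewrite -p8 -p7 eq_sym.
- by rewrite -p8 -p5 -p4 eq_sym.
- by rewrite -p7 -p2 -p4 -p1 eq_sym.
move=> z.
by rewrite -E3 -mulmxA -E2 mulmxA -E1 -mulmxA F1 mulmxA F2 -mulmxA F3 mulmxA.
Qed.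

End YangBaxter.

Theorem proposition4p8 (R : realType) (n : nat) (hn : (4 <= n)%N)
    (T : ratmap R (dimB n + dimB n) (dimB n + dimB n))
    (hT : is_tropicalR T) :
  rational_eq (pcomp (R12 T) (pcomp (R23 T) (R12 T)))
              (pcomp (R23 T) (pcomp (R12 T) (R23 T))).
Proof.
have [birT genT] := hT.
have [L12 L12E] := R12_ratmap T.
have [L23 L23E] := R23_ratmap T.
have dom12 : dominant L12.
  by apply: generic_mono (R12_dominant birT) => w [v]; exists v; rewrite L12E.
have dom23 : dominant L23.
  by apply: generic_mono (R23_dominant birT) => w [v]; exists v; rewrite L23E.
have lf12 : locally_fraction (R12 T).
  by rewrite -(funext L12E); apply: ratmap_locally_fraction.
have lf23 : locally_fraction (R23 T).
  by rewrite -(funext L23E); apply: ratmap_locally_fraction.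
apply: rational_eq_of_generic; try by do ![apply: pcomp_locally_fraction => //].
pose good (v : 'rV[R]_(dimB n + dimB n)) := exists2 w, T v = Some w &
  refactors (lsubmx v) (rsubmx v) (lsubmx w) (rsubmx w).
have gen_good : generic good.
  apply: generic_mono genT => v [_ _ [w Tv h]]; exists w => //.
  by apply/h; rewrite hsubmxK.
pose D := dimB n.
pose step12 (t u : 'rV[R]_(D + D + D)) := [/\ R12 T t = Some u,
  rsubmx u = rsubmx t & refactors (lsubmx (lsubmx t)) (rsubmx (lsubmx t))
    (lsubmx (lsubmx u)) (rsubmx (lsubmx u))].
pose step23 (t u : 'rV[R]_(D + D + D)) := [/\ R23 T t = Some u,
  lsubmx (lsubmx u) = lsubmx (lsubmx t) &
  refactors (rsubmx (lsubmx t)) (rsubmx t) (rsubmx (lsubmx u)) (rsubmx u)].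
have gen12 : generic (fun t => exists u, step12 t u).
  apply: generic_mono (generic_gather (@pos12_inj D) gen_good) => t.
  rewrite gather_pos12 => -[w Tt h]; exists (row_mx w (rsubmx t)).
  by rewrite /step12 /R12 Tt row_mxKl row_mxKr.
have gen23 : generic (fun t => exists u, step23 t u).
  apply: generic_mono (generic_gather (@pos23_inj D) gen_good) => t.
  rewrite gather_pos23 => -[w Tt]; rewrite !row_mxKl !row_mxKr => h.
  exists (row_mx (row_mx (lsubmx (lsubmx t)) (lsubmx w)) (rsubmx w)).
  by rewrite /step23 /R23 Tt /= !row_mxKl !row_mxKr.
have gen_left := generic_and gen12 (generic_pullback dom12
  (generic_and gen23 (generic_pullback dom23 gen12))).
have gen_right := generic_and gen23 (generic_pullback dom23
  (generic_and gen12 (generic_pullback dom12 gen23))).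
apply: generic_mono (generic_and gen_left gen_right) => t.
case=> [[[t1 [e1 r1 h1]]]].
case=> t1'; rewrite L12E e1 => -[<-] [[t2 [e2 r2 h2]]].
case=> t2'; rewrite L23E e2 => -[<-] [t3 [e3 r3 h3]].
case=> [[s1 [f1 q1 k1]]].
case=> s1'; rewrite L23E f1 => -[<-] [[s2 [f2 q2 k2]]].
case=> s2'; rewrite L12E f2 => -[<-] [s3 [f3 q3 k3]].
exists t3; first by rewrite /pcomp e1 /= e2 /= e3.
rewrite /pcomp f1 /= f2 /= f3; congr Some.
rewrite r1 in h2; rewrite r2 in h3; rewrite q1 in k2; rewrite q2 in k3.
have [a1 a2 a3] := refactors_braid hn h1 h2 h3 k1 k2 k3.
rewrite -[t3]hsubmxK -[s3]hsubmxK -[lsubmx t3]hsubmxK -[lsubmx s3]hsubmxK.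
by rewrite a1 a2 r3 a3 q3.
Qed.
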